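(* Let $X_{i\ell}$, $1\le i\le n$, $1\le\ell\le L_i$, be independent random vectors, $G=(V,E)$ a graph on $V=\{1,\dots,n\}$ with maximum node degree $d_{\max}$, $\{h_e\}_{e\in E}$ a collection of bivariate kernels, and $$U_1=\sum_{e=(i,j)\in E}\sum_{\ell=1}^{L_i}\sum_{k=1}^{L_j}h_e(X_{i\ell},X_{jk}).$$ Suppose that for every $e=(i,j)\in E$ there exists $\sigma_e>0$ such that for all $1\le\ell\le L_i$ and $1\le k\le L_j$, $$\mathbb{E}\Bigl[e^{\lambda\{h_e(X_{i\ell},X_{jk})-\mathbb{E}h_e(X_{i\ell},X_{jk})\}}\Bigr]\le e^{\lambda^2\sigma_e^2/2}\qquad\text{for all }\lambda>0.$$ Then, for all $t>0$, $$\mathbb{P}(U_1-\mathbb{E}U_1>t)\le\exp\left\{-\frac{t^2}{2(d_{\max}+1)\sum_{e=(i,j)\in E}L_iL_j(L_i\vee L_j)\sigma_e^2}\right\}.$$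
   Context: The random vectors $X_{i\ell}\in\mathbb{R}^p$ are (jointly) independent but not necessarily identically distributed, and each $L_i\ge1$ is a deterministic integer. $G=(V,E)$ is an arbitrary deterministic simple undirected graph with at least one edge; each edge $e\in E$ is written as a pair $e=(i,j)$ in one fixed order of its endpoints. For each $e\in E$, $h_e:\mathbb{R}^p\times\mathbb{R}^p\to\mathbb{R}$ is a measurable function (kernel), which may depend on $e$ and need not be symmetric; the expectations $\mathbb{E}h_e(X_{i\ell},X_{jk})$ are finite. Notation: $a\vee b=\max\{a,b\}$. *)

(* Defs.v *)
From HB Require Import structures.
From mathcomp Require Import all_boot all_order all_algebra.
From mathcomp Require Import all_classical all_reals all_analysis.

Set Implicit Arguments.
Unset Strict Implicit.
Unset Printing Implicit Defensive.

Import Order.TTheory GRing.Theory Num.Theory.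

Local Open Scope classical_set_scope.
Local Open Scope ring_scope.

Definition mutually_independent d d' (T : measurableType d)
    (S : measurableType d') (R : realType) (P : probability T R)
    (I : finType) (X : I -> T -> S) : Prop :=
  forall (J : {set I}) (A : I -> set S),
    (forall i, i \in J -> measurable (A i)) ->
    P [set w | forall i, i \in J -> A i (X i w)] =
    (\prod_(i in J) P (X i @^-1` A i))%E.

Definition simple_graph (V : finType) (adj : rel V) : Prop :=
  symmetric adj /\ irreflexive adj.

(* E lists every edge {i, j} of adj exactly once, as one of the two ordered
   pairs (i, j), (j, i). *)
Definition edge_pairs (V : finType) (adj : rel V) (E : {set V * V}) : Prop :=
  (forall i j, (i, j) \in E -> (j, i) \notin E) /\
  (forall i j, adj i j = ((i, j) \in E) || ((j, i) \in E)).

Definition max_degree (V : finType) (adj : rel V) : nat :=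
  (\max_(i : V) #|[pred j | adj i j]|)%N.

(* R^p is p.-tuple R, whose sigma-algebra is the one generated by the p
   coordinates, i.e. the Borel one.  The sample X i l is the (l+1)-th of the L i
   vectors attached to the node i. *)
Definition U1 (R : realType) (T : Type) (p n : nat) (L : 'I_n -> nat)
    (E : {set 'I_n * 'I_n})
    (h : 'I_n * 'I_n -> p.-tuple R -> p.-tuple R -> R)
    (X : forall i : 'I_n, 'I_(L i) -> T -> p.-tuple R) (w : T) : R :=
  \sum_(e in E) \sum_(l < L e.1) \sum_(k < L e.2)
    h e (X e.1 l w) (X e.2 k w).

(* Main.v *)
Require Import Defs.
From HB Require Import structures.
From mathcomp Require Import all_boot all_order all_algebra.
From mathcomp Require Import all_classical all_reals all_analysis.
From mathcomp Require Import measurable_realfun ring.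

(** The dependence between the terms is handled by fractional weights and
    Finner's inequality, without splitting the edges into matchings.

    View [U1] as a sum over the pairs [(i, l), (j, k)] with [(i, j)] an edge:
    these pairs are the edges of a graph on the sample points [(i, l)], and
    each term depends on the two independent vectors at its ends.  Suppose
    that the pairs [z] carry weights [w z > 0] whose sum over the pairs
    containing any given sample point is at most 1.  Finner's inequality
    [finner] then says that, for nonnegative functions [g z] of the two vectors
    at the ends of [z],
      [E (\prod_z g z ^ w z) <= \prod_z (E (g z)) ^ w z].
    It is proved by integrating out one sample point at a time: the weights of
    the pairs that contain this point sum to at most 1, so the generalised
    Hoelder inequality [hoelder_prod] applies, and it leaves a product of the
    same shape in which every [g z] is replaced by its average over that point.

    Applied to [g z = exp (lambda / w z * (term z - E (term z)))], the
    inequality shows that a sum of centred terms with variance proxies [s z]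
    has variance proxy [\sum_z s z / w z] ([subgauss_sum]).  With
    [d = d_max], give each pair over the edge [e = (i, j)] the weight
    [1 / ((d + 1) * max (L i) (L j))].  A sample point [(i, l)] lies in [L j]
    pairs over [e], whose weights add up to at most [1 / (d + 1)]; there are at
    most [d] edges at [i], so the weights at [(i, l)] add up to at most
    [d / (d + 1)] ([pair_weight_cover]).  The variance proxy becomes
      [\sum_e L i * L j * ((d + 1) * max (L i) (L j)) * sigma e ^ 2],
    and Chernoff's bound at the optimal [lambda] gives the tail
    ([subgauss_tail]). *)

Set Implicit Arguments.
Unset Strict Implicit.
Unset Printing Implicit Defensive.

Import Order.TTheory GRing.Theory Num.Theory.

Local Open Scope classical_set_scope.
Local Open Scope ring_scope.

(** * Generalised Hölder inequality *)

(** The term [1 - \sum w] is the contribution of an extra entry equal to 1,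
    which completes the weights to a probability vector. *)
Lemma weighted_amgm (R : realType) (I : finType) (J : pred I) (w x : I -> R)
    (w_gt0 : forall i, J i -> 0 < w i) (w_le1 : \sum_(i | J i) w i <= 1)
    (x_ge0 : forall i, J i -> 0 <= x i) :
  \prod_(i | J i) x i `^ w i
    <= \sum_(i | J i) w i * x i + (1 - \sum_(i | J i) w i).
Proof.
have rhs_ge0 : 0 <= \sum_(i | J i) w i * x i + (1 - \sum_(i | J i) w i).
  rewrite addr_ge0 ?subr_ge0// sumr_ge0// => i Ji.
  by rewrite mulr_ge0 ?x_ge0// ltW ?w_gt0.
have [/existsP[i /andP[Ji /eqP xi0]]|] := boolP [exists i, J i && (x i == 0)].
  by rewrite (bigD1 i)//= xi0 powR0 ?mul0r// gt_eqF ?w_gt0.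
rewrite negb_exists => /forallP xN0.
have x_gt0 i : J i -> 0 < x i.
  by move=> Ji; rewrite lt0r x_ge0// andbT; move: (xN0 i); rewrite Ji.
pose m := \sum_(i | J i) w i * ln (x i).
have -> : \prod_(i | J i) x i `^ w i = expR m.
  rewrite expR_sum; apply: eq_bigr => i Ji.
  by rewrite /powR gt_eqF// x_gt0.
(* the tangent of exp at m, evaluated at each ln (x i) and at 0 *)
have tangent y : expR m * (1 + (y - m)) <= expR y.
  rewrite -[in leRHS](subrKC m y) expRD.
  by rewrite ler_pM2l ?expR_gt0// expR_ge1Dx.
pose s := \sum_(i | J i) w i.
have -> : expR m = \sum_(i | J i) w i * (expR m * (1 + (ln (x i) - m)))
    + (1 - s) * (expR m * (1 + (0 - m))).
  rewrite (eq_bigr (fun i => expR m * (w i * ln (x i))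
    + expR m * (1 - m) * w i)); last by move=> i _; ring.
  by rewrite big_split/= -!mulr_sumr -/m -/s; ring.
apply: lerD.
  apply: ler_sum => i Ji; rewrite ler_pM2l ?w_gt0//.
  by rewrite (le_trans (tangent _))// lnK// posrE x_gt0.
by rewrite ler_piMr ?subr_ge0// (le_trans (tangent _))// expR0.
Qed.

Section extended_products.
Local Open Scope ereal_scope.

Lemma prode_gt0 (R : realType) (I : Type) (r : seq I) (J : pred I)
    (x : I -> \bar R) :
  (forall i, J i -> 0 < x i) -> 0 < \prod_(i <- r | J i) x i.
Proof.
by move=> x_gt0; apply: (big_ind (fun a : \bar R => 0 < a)) => //;
  exact: mule_gt0.
Qed.

Lemma lee_prod (R : realType) (I : Type) (r : seq I) (J : pred I)
    (x y : I -> \bar R) :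
  (forall i, J i -> 0 <= x i <= y i) ->
  \prod_(i <- r | J i) x i <= \prod_(i <- r | J i) y i.
Proof.
move=> xy; suff /andP[] : 0 <= \prod_(i <- r | J i) x i
    <= \prod_(i <- r | J i) y i by [].
apply: (big_ind2 (fun a b : \bar R => 0 <= a <= b)) => //.
- by rewrite lexx lee01.
- move=> a b c e /andP[a0 ab] /andP[c0 ce].
  by rewrite mule_ge0//= lee_pmul.
Qed.

Lemma prode_pinfty (R : realType) (I : finType) (J : pred I)
    (x : I -> \bar R) (i : I) :
  J i -> x i = +oo -> (forall j, J j -> 0 < x j) -> \prod_(j | J j) x j = +oo.
Proof.
move=> Ji xi x_gt0; rewrite (bigD1 i)//= xi gt0_mulye// prode_gt0// => j.
by case/andP => Jj _; exact: x_gt0.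
Qed.

Lemma emeasurable_prod d (T : measurableType d) (R : realType) (I : Type)
    (r : seq I) (J : pred I) (f : I -> T -> \bar R) :
  (forall i, J i -> measurable_fun setT (f i)) ->
  measurable_fun setT (fun x => \prod_(i <- r | J i) f i x).
Proof.
move=> mf; elim: r => [|i r ih].
  by rewrite (_ : (fun=> _) = cst 1)//; apply/funext => x; rewrite big_nil.
have [Ji|Jni] := boolP (J i); last first.
  by rewrite (_ : (fun=> _) = fun x => \prod_(j <- r | J j) f j x)//;
    apply/funext => x; rewrite big_cons (negbTE Jni).
rewrite (_ : (fun=> _) = fun x => f i x * \prod_(j <- r | J j) f j x).
  exact: emeasurable_funM (mf _ Ji) ih.
by apply/funext => x; rewrite big_cons Ji.
Qed.

End extended_products.

Section hoelder.
Local Open Scope ereal_scope.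

(** Dividing each [g i] by its integral turns the claim into the integral of
    [weighted_amgm]; an integral equal to 0 forces the left-hand side to vanish,
    and an infinite one makes the right-hand side infinite. *)
Lemma hoelder_prod d (T : measurableType d) (R : realType)
    (mu : probability T R) (I : finType) (J : pred I) (w : I -> R)
    (g : I -> T -> \bar R) :
  (forall i, J i -> (0 < w i)%R) -> (\sum_(i | J i) w i <= 1)%R ->
  (forall i, measurable_fun setT (g i)) -> (forall i x, 0 <= g i x) ->
  \int[mu]_x \prod_(i | J i) g i x `^ w i
    <= \prod_(i | J i) (\int[mu]_x g i x) `^ w i.
Proof.
move=> w_gt0 w_le1 mg g_ge0.
have mprod : measurable_fun setT (fun x => \prod_(i | J i) g i x `^ w i).
  apply: emeasurable_prod => i Ji.
  exact: (measurableT_comp (measurable_poweR _)).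
have int_ge0 i : 0 <= \int[mu]_x g i x.
  by apply: integral_ge0 => x _; exact: g_ge0.
have [/existsP[i /andP[Ji /eqP gi0]]|] :=
    boolP [exists i, J i && (\int[mu]_x g i x == 0)].
  have gi_ae0 : ae_eq mu setT (g i) (cst 0).
    apply/(ae_eq_integral_abs mu measurableT (mg i)).
    rewrite -[RHS]gi0; apply: eq_integral => x _.
    by rewrite gee0_abs// g_ge0.
  rewrite (ge0_ae_eq_integral measurableT mprod (measurable_cst 0)) //.
  - rewrite integral0 prode_ge0// => j Jj; exact: poweR_ge0.
  - by move=> x _; apply: prode_ge0 => j Jj; exact: poweR_ge0.
  - move: gi_ae0; apply: filterS => x /(_ Logic.I) /= gix0 _.
    by rewrite (bigD1 i)//= gix0 poweR0r ?mul0e// gt_eqF ?w_gt0.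
rewrite negb_exists => /forallP intN0.
have int_gt0 i : J i -> 0 < \int[mu]_x g i x.
  by move=> Ji; rewrite lt0e int_ge0// andbT; move: (intN0 i); rewrite Ji.
have [/existsP[i /andP[Ji /eqP giy]]|] :=
    boolP [exists i, J i && (\int[mu]_x g i x == +oo)].
  rewrite (@prode_pinfty _ _ _ _ i)//= ?leey//.
    by rewrite giy poweRyr// gt_eqF ?w_gt0.
  by move=> j Jj; rewrite poweR_gt0// int_gt0.
rewrite negb_exists => /forallP intNy.
pose r i := fine (\int[mu]_x g i x).
have rE i : J i -> \int[mu]_x g i x = (r i)%:E.
  move=> Ji; rewrite fineK// ge0_fin_numE ?int_ge0// lt_neqAle leey andbT.
  by move: (intNy i); rewrite Ji.
have r_gt0 i : J i -> (0 < r i)%R.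
  by move=> Ji; rewrite -lte_fin -rE// int_gt0.
pose K := (\prod_(i | J i) r i `^ w i)%R.
have K_gt0 : (0 < K)%R by apply: prodr_gt0 => i Ji; rewrite powR_gt0 ?r_gt0.
pose c i := if J i then (w i / r i)%R else 0%R.
have cE i : J i -> c i = (w i / r i)%R by rewrite /c => ->.
have c_gt0 i : J i -> (0 < c i)%R.
  by move=> Ji; rewrite cE// divr_gt0 ?w_gt0 ?r_gt0.
have c_ge0 i : (0 <= c i)%R.
  by have [/c_gt0/ltW//|/negbTE Jni] := boolP (J i); rewrite /c Jni.
pose bound x := \sum_(i <- enum J) (c i)%:E * g i x
  + (1 - \sum_(i | J i) w i)%:E.
have sum_ge0 x : 0 <= \sum_(i <- enum J) (c i)%:E * g i x.
  rewrite big_enum/=; apply: sume_ge0 => i Ji.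
  by rewrite mule_ge0 ?g_ge0// lee_fin.
have msum : measurable_fun setT
    (fun x => \sum_(i <- enum J) (c i)%:E * g i x).
  by apply: emeasurable_sum => i; exact: measurable_funeM.
have bound_ge0 x : 0 <= bound x by rewrite adde_ge0// lee_fin subr_ge0.
have mbound : measurable_fun setT bound by exact: emeasurable_funD.
have le_bound x : \prod_(i | J i) g i x `^ w i <= K%:E * bound x.
  have [/existsP[i /andP[Ji /eqP giy]]|] :=
      boolP [exists i, J i && (g i x == +oo)].
    suff -> : bound x = +oo by rewrite gt0_muley ?lte_fin ?leey.
    rewrite /bound big_enum/= (bigD1 i)//= giy gt0_muley ?lte_fin ?c_gt0//.
    rewrite addye ?addye// gt_eqF// (lt_le_trans ltNy0)// sume_ge0//.
    by move=> j /andP[Jj _]; rewrite mule_ge0// lee_fin.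
  rewrite negb_exists => /forallP gNy.
  pose y i := fine (g i x).
  have yE i : J i -> g i x = (y i)%:E.
    move=> Ji; rewrite fineK// ge0_fin_numE ?g_ge0// lt_neqAle leey andbT.
    by move: (gNy i); rewrite Ji.
  have y_ge0 i : J i -> (0 <= y i)%R.
    by move=> Ji; rewrite -lee_fin -yE// g_ge0.
  rewrite (eq_bigr (fun i => (y i `^ w i)%:E)); last first.
    by move=> i Ji; rewrite yE.
  rewrite prodEFin /bound big_enum/=.
  rewrite (eq_bigr (fun i => (c i * y i)%:E)); last first.
    by move=> i Ji; rewrite yE.
  rewrite sumEFin -EFinD -EFinM lee_fin.
  rewrite (eq_bigr (fun i => r i `^ w i * (y i / r i) `^ w i))%R; last first.
    move=> i Ji; rewrite -powRM ?divr_ge0 ?y_ge0// ?ltW ?r_gt0//.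
    by rewrite mulrC divfK// gt_eqF ?r_gt0.
  rewrite big_split/= ler_pM2l//.
  apply: le_trans (weighted_amgm w_gt0 w_le1 _) _.
    by move=> i Ji; rewrite divr_ge0 ?y_ge0// ltW ?r_gt0.
  by rewrite lerD2r ler_sum// => i Ji; rewrite cE// mulrAC mulrA.
apply: (@le_trans _ _ (\int[mu]_x (K%:E * bound x))).
  apply: ge0_le_integral => //.
  - by move=> x _; apply: prode_ge0 => i Ji; exact: poweR_ge0.
  - exact: measurable_funeM.
rewrite ge0_integralZl//; last by rewrite lee_fin ltW.
rewrite /bound ge0_integralD//; last by move=> x _; rewrite lee_fin subr_ge0.
rewrite ge0_integral_sum//; last 2 first.
- by move=> i; exact: measurable_funeM.
- by move=> i x _; rewrite mule_ge0// lee_fin.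
rewrite integral_cst//= probability_setT mule1 big_enum/=.
rewrite (eq_bigr (fun i => (w i)%:E)) => [|i Ji]; last first.
  rewrite ge0_integralZl// ?lee_fin// rE// -EFinM cE// divfK//.
  by rewrite gt_eqF ?r_gt0.
rewrite sumEFin -EFinD subrKC mule1 (eq_bigr (fun i => (r i `^ w i)%:E)).
  by rewrite prodEFin.
by move=> i Ji; rewrite rE.
Qed.

End hoelder.

(** * Independent families as points of a product space *)

(** A family [X : V -> T -> S] is treated as one random point of [V -> S],
    measurable for the sigma-algebra generated by boxes.  Boxes form a
    pi-system on which mutual independence determines the law. *)
Definition boxes d (S : measurableType d) (V : finType) : set (set (V -> S)) :=
  [set [set x | forall v, A v (x v)] |
    A in [set A | forall v, measurable (A v)]].

Notation config S V := (g_sigma_algebraType (@boxes _ S V)).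

Lemma measurable_box d (S : measurableType d) (V : finType) (A : V -> set S) :
  (forall v, measurable (A v)) ->
  measurable ([set x | forall v, A v (x v)] : set (config S V)).
Proof. by move=> mA; apply: sub_sigma_algebra; exists A. Qed.

Lemma setI_closed_boxes d (S : measurableType d) (V : finType) :
  setI_closed (@boxes _ S V).
Proof.
move=> _ _ [A mA <-] [B mB <-]; exists (fun v => A v `&` B v).
  by move=> v; exact: measurableI.
by apply/seteqP; split=> x /= => [AB|[Ax Bx] v]; split=> // v; case: (AB v).
Qed.

Lemma measurable_config d (S : measurableType d) (V : finType)
    d' (T : measurableType d') (f : T -> config S V) :
  (forall v, measurable_fun setT (fun w => f w v)) -> measurable_fun setT f.
Proof.
move=> mf; apply: (@measurability _ _ _ (config S V) _ _ (@boxes _ S V)).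
  by [].
move=> _ [_ [A mA <-] <-]; rewrite setTI.
rewrite (_ : _ @^-1` _ = \bigcap_(v in setT) ((fun w => f w v) @^-1` A v)).
  apply: fin_bigcap_measurable => // v _; rewrite -[X in measurable X]setTI.
  exact: mf.
by apply/seteqP; split => [w Aw v _|w Aw v]; exact: Aw.
Qed.

Lemma measurable_coord d (S : measurableType d) (V : finType) (v : V) :
  measurable_fun setT (fun x : config S V => x v).
Proof.
move=> _ A mA; rewrite setTI.
pose B u := if u == v then A else setT.
rewrite (_ : _ @^-1` _ = [set x | forall u, B u (x u)]).
  by apply: measurable_box => u; rewrite /B; case: ifP.
rewrite /B; apply/seteqP; split => x /= => [Ax u|/(_ v)]; last by rewrite eqxx.
by case: eqP => [->|].
Qed.

Section resampling.
Local Open Scope ereal_scope.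
Context d d' (T : measurableType d) (S : measurableType d') (R : realType).
Context (P : probability T R) (V : finType) (X : V -> T -> S).
Hypothesis mX : forall v, measurable_fun setT (X v).
Hypothesis X_indep : mutually_independent P X.

Let sample (w : T) : config S V := X ^~ w.
Let resample v (w : T * T) : config S V := [eta X ^~ w.1 with v |-> X v w.2].

Let measurable_sample : measurable_fun setT sample.
Proof. exact: measurable_config. Qed.

Let measurable_resample v : measurable_fun setT (resample v).
Proof.
apply: measurable_config => u; rewrite /resample /=.
case: (u == v); first exact: measurableT_comp (mX v) measurable_snd.
exact: measurableT_comp (mX u) measurable_fst.
Qed.

Let sample_box A : (forall v, measurable (A v)) ->
  P (sample @^-1` [set x | forall v, A v (x v)])
  = \prod_(v : V) P (X v @^-1` A v).
Proof.
move=> mA; have := X_indep (J := finset.setT) (fun v _ => mA v).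
rewrite (_ : [set w | _] = sample @^-1` [set x | forall v, A v (x v)]).
  move=> ->; apply: eq_bigl => v; exact: finset.in_setT.
by apply/seteqP; split=> w /= Aw v //; apply: Aw; exact: finset.in_setT.
Qed.

Let resample_box v A : (forall v, measurable (A v)) ->
  (P \x P) (resample v @^-1` [set x | forall v, A v (x v)])
  = \prod_(v : V) P (X v @^-1` A v).
Proof.
move=> mA; pose J := finset.setC (finset.set1 v).
pose B := [set w | forall u, u \in J -> A u (X u w)].
have mXA u : measurable (X u @^-1` A u).
  by rewrite -[X in measurable X]setTI; exact: mX.
rewrite (_ : _ @^-1` _ = B `*` (X v @^-1` A v)); last first.
  apply/seteqP; split => [[w1 w2] /= Aw|[w1 w2] [/= Bw1 Avw2] u /=].
    split=> [u /= uJ|]; last by have := Aw v; rewrite /resample /= eqxx.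
    move: uJ (Aw u); rewrite finset.in_setC1 => uv.
    by rewrite /resample /= (negbTE uv).
  rewrite /resample /=; case: eqP => [->//|/eqP uv]; apply: Bw1.
  by rewrite finset.in_setC1.
have mB : measurable B.
  exact: (@fin_bigcap_measurable _ _ _ [set` J] (fun u => X u @^-1` A u)).
transitivity (P B * P (X v @^-1` A v)); first exact: product_measure1E.
rewrite (X_indep (J := J) (A := A))// muleC [RHS](bigD1 v)//=; congr (_ * _).
by apply: eq_bigl => u; rewrite finset.in_setC1.
Qed.

(** The point [X] has the same law as the point obtained by drawing its
    [v]-th coordinate afresh: on a box, both laws give the product of the
    marginal probabilities.  The inner integral thus integrates out [X v] with
    the other coordinates held fixed. *)
Lemma integral_resample (v : V) (G : config S V -> \bar R) :
  measurable_fun setT G -> (forall x, 0 <= G x) ->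
  \int[P]_w G (X ^~ w)
  = \int[P]_w \int[P]_w' G [eta X ^~ w with v |-> X v w'].
Proof.
move=> mG G_ge0.
have mGr : measurable_fun setT (G \o resample v).
  exact: measurableT_comp mG (measurable_resample v).
have Gr_ge0 w : 0 <= (G \o resample v) w by exact: G_ge0.
transitivity (\int[P \x P]_w (G \o resample v) w); last first.
  exact: (fubini_tonelli1 (G \o resample v)).
transitivity (\int[pushforward (P \x P) (resample v)]_x G x); last first.
  by rewrite (ge0_integral_pushforward (measurable_resample v)).
transitivity (\int[pushforward P sample]_x G x).
  by rewrite (ge0_integral_pushforward measurable_sample).
apply: eq_measure_integral => A mA _.
apply: (@measure_unique _ R (config S V) (@boxes _ S V) (fun=> setT)) => //.
- exact: setI_closed_boxes.
- by move=> n; exists (fun=> setT) => //; apply/seteqP; split.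
- by rewrite bigcup_const//; exists 0%N.
- move=> _ [B mB <-]; transitivity (\prod_(v : V) P (X v @^-1` B v)).
    exact: sample_box.
  by symmetry; exact: resample_box.
- by move=> n; rewrite /= /pushforward preimage_setT probability_setT ltry.
Qed.

End resampling.

(** * Finner's inequality *)

Section finner.
Local Open Scope ereal_scope.
Context d d' (T : measurableType d) (S : measurableType d') (R : realType).
Context (P : probability T R) (V : finType) (X : V -> T -> S).
Hypothesis mX : forall v, measurable_fun setT (X v).
Hypothesis X_indep : mutually_independent P X.
Context (I : finType) (J : pred I) (w : I -> R) (A : I -> {set V}).
Hypothesis w_gt0 : forall i, J i -> (0 < w i)%R.
Hypothesis w_cover : forall v, (\sum_(i | J i && (v \in A i)) w i <= 1)%R.

Let reveal (v : V) (z : config S V * T) : config S V :=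
  [eta z.1 with v |-> X v z.2].

Let measurable_reveal v : measurable_fun setT (reveal v).
Proof.
apply: measurable_config => u; rewrite /reveal /=.
case: (u == v); first exact: measurableT_comp (mX v) measurable_snd.
exact: measurableT_comp (measurable_coord u) measurable_fst.
Qed.

Definition average_out (v : V) (g : config S V -> \bar R) (x : config S V) :=
  \int[P]_w g [eta x with v |-> X v w].

Lemma measurable_average_out v g : measurable_fun setT g ->
  (forall x, 0 <= g x) -> measurable_fun setT (average_out v g).
Proof.
move=> mg g_ge0.
apply: (measurable_fun_fubini_tonelli_F (g \o reveal v)).
  exact: measurableT_comp mg (measurable_reveal v).
by move=> z; exact: g_ge0.
Qed.

(** Only the factors [g i] with [v \in A i] vary when the coordinate [v] is
    redrawn; their weights sum to at most 1 and Hoelder applies, while the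
    other factors are constants equal to their own average. *)
Lemma hoelder_average_out (v : V) (g : I -> config S V -> \bar R)
    (x : config S V) :
  (forall i, measurable_fun setT (g i)) -> (forall i x, 0 <= g i x) ->
  (forall i x y, (forall u, u \in A i -> x u = y u) -> g i x = g i y) ->
  average_out v (fun y => \prod_(i | J i) g i y `^ w i) x
    <= \prod_(i | J i) average_out v (g i) x `^ w i.
Proof.
move=> mg g_ge0 g_dep.
have mslice i : measurable_fun setT (fun t => g i [eta x with v |-> X v t]).
  apply: measurableT_comp (mg i) _.
  exact: measurableT_comp (measurable_reveal v) (pair1_measurable x).
rewrite /average_out [leRHS](bigID (fun i => v \in A i))/=.
pose c := \prod_(i | J i && (v \notin A i)) g i x `^ w i.
have c_ge0 : 0 <= c by apply: prode_ge0 => i _; exact: poweR_ge0.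
have gE i t : v \notin A i -> g i [eta x with v |-> X v t] = g i x.
  move=> vAi; apply: g_dep => u uAi /=; case: eqP => // uv.
  by rewrite -uv uAi in vAi.
under eq_integral do rewrite (bigID (fun i => v \in A i))/= muleC.
rewrite (eq_integral (fun t => c * \prod_(i | J i && (v \in A i))
    g i [eta x with v |-> X v t] `^ w i)); last first.
  move=> t _; congr (_ * _)%E; apply: eq_bigr => i /andP[_ vAi].
  by rewrite gE.
pose F t := \prod_(i | J i && (v \in A i)) g i [eta x with v |-> X v t] `^ w i.
have F_ge0 t : 0 <= F t by apply: prode_ge0 => i _; exact: poweR_ge0.
have mF : measurable_fun setT F.
  apply: emeasurable_prod => i _.
  exact: (measurableT_comp (measurable_poweR _) (mslice i)).
rewrite (ge0_integralZl P measurableT mF)// muleC lee_pmul ?integral_ge0//.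
  apply: (@hoelder_prod _ _ _ P _ _ w
    (fun i t => g i [eta x with v |-> X v t]) _ (w_cover v)) => //.
  by move=> i /andP[Ji _]; exact: w_gt0.
apply: lee_prod => i /andP[_ vAi]; rewrite poweR_ge0//=.
under eq_integral do rewrite gE//.
by rewrite integral_cst//= probability_setT mule1.
Qed.

(** The list holds the sample points that are not yet integrated out.
    Averaging over its head frees the functions from that coordinate and, by
    [integral_resample], leaves their expectations unchanged. *)
Lemma finner_seq (s : seq V) (g : I -> config S V -> \bar R) :
  (forall i, measurable_fun setT (g i)) -> (forall i x, 0 <= g i x) ->
  (forall i x y, (forall v, v \in A i -> v \in s -> x v = y v) ->
    g i x = g i y) ->
  \int[P]_t \prod_(i | J i) g i (X ^~ t) `^ w i
    <= \prod_(i | J i) (\int[P]_t g i (X ^~ t)) `^ w i.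
Proof.
elim: s g => [|v s IH] g mg g_ge0 g_dep.
  have gE i x : g i x = g i point by apply: g_dep.
  under eq_integral do under eq_bigr do rewrite gE.
  rewrite integral_cst//= probability_setT mule1.
  apply: lee_prod => i Ji; rewrite poweR_ge0//=.
  under eq_integral do rewrite gE.
  by rewrite integral_cst//= probability_setT mule1.
pose G x := \prod_(i | J i) g i x `^ w i.
have mG : measurable_fun setT G.
  apply: emeasurable_prod => i Ji.
  exact: (measurableT_comp (measurable_poweR _)).
have G_ge0 x : 0 <= G x by apply: prode_ge0 => i _; exact: poweR_ge0.
have avg_ge0 f x : (forall y, 0 <= f y) -> 0 <= average_out v f x.
  by move=> f_ge0; apply: integral_ge0.
have msample : measurable_fun setT (fun t => X ^~ t : config S V).
  exact: measurable_config.
have mavg i : measurable_fun setT (average_out v (g i)).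
  exact: measurable_average_out.
rewrite (integral_resample mX X_indep v mG G_ge0).
apply: (@le_trans _ _
    (\int[P]_t \prod_(i | J i) average_out v (g i) (X ^~ t) `^ w i)).
  apply: ge0_le_integral => //.
  - by move=> t _; exact: avg_ge0.
  - exact: measurableT_comp (measurable_average_out v mG G_ge0) msample.
  - apply: emeasurable_prod => i Ji.
    apply: (measurableT_comp (measurable_poweR _)).
    exact: measurableT_comp (mavg i) msample.
  - move=> t _; apply: hoelder_average_out => // i x y xy.
    by apply: g_dep => u uAi _; exact: xy.
apply: (le_trans (IH (fun i => average_out v (g i)) _ _ _)) => //.
- by move=> i x; exact: avg_ge0.
- move=> i x y xy; apply: eq_integral => t _; apply: g_dep => u uAi /=.
  by rewrite inE; case: eqP => //= _; exact: xy.
apply: lee_prod => i Ji; rewrite poweR_ge0//=.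
by rewrite (integral_resample mX X_indep v (mg i) (g_ge0 i)).
Qed.

Lemma finner (g : I -> config S V -> \bar R) :
  (forall i, measurable_fun setT (g i)) -> (forall i x, 0 <= g i x) ->
  (forall i x y, (forall v, v \in A i -> x v = y v) -> g i x = g i y) ->
  \int[P]_t \prod_(i | J i) g i (X ^~ t) `^ w i
    <= \prod_(i | J i) (\int[P]_t g i (X ^~ t)) `^ w i.
Proof.
move=> mg g_ge0 g_dep; apply: (finner_seq (s := enum V)) => // i x y xy.
by apply: g_dep => v vAi; apply: xy => //; rewrite mem_enum.
Qed.

End finner.

(** * Sub-Gaussian sums and their tails *)

(** [finner] with [g i = exp (lambda / w i * f i)]: raising the bound
    [exp ((lambda / w i) ^ 2 * s i / 2)] to the power [w i] leaves a single
    factor [1 / w i] in the exponent. *)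
Lemma subgauss_sum d d' (T : measurableType d) (S : measurableType d')
    (R : realType) (P : probability T R) (V : finType) (X : V -> T -> S)
    (I : finType) (J : pred I) (w s : I -> R) (A : I -> {set V})
    (f : I -> config S V -> R) :
  (forall v, measurable_fun setT (X v)) -> mutually_independent P X ->
  (forall i, J i -> 0 < w i) ->
  (forall v, \sum_(i | J i && (v \in A i)) w i <= 1) ->
  (forall i, measurable_fun setT (f i)) ->
  (forall i x y, (forall v, v \in A i -> x v = y v) -> f i x = f i y) ->
  (forall i lambda, J i -> 0 < lambda ->
    (\int[P]_t (expR (lambda * f i (X ^~ t)))%:E
      <= (expR (lambda ^+ 2 * s i / 2))%:E)%E) ->
  forall lambda, 0 < lambda ->
  (\int[P]_t (expR (lambda * \sum_(i | J i) f i (X ^~ t)))%:E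
    <= (expR (lambda ^+ 2 * (\sum_(i | J i) s i / w i) / 2))%:E)%E.
Proof.
move=> mX X_indep w_gt0 w_cover mf f_dep mgf lambda lambda_gt0.
pose g i x := (expR (lambda / w i * f i x))%:E.
have gwE i r : J i -> expR (lambda / w i * r) `^ w i = expR (lambda * r).
  by move=> Ji; rewrite -expRM mulrAC divfK// gt_eqF ?w_gt0.
rewrite (eq_integral
    (fun t => (\prod_(i | J i) (g i (X ^~ t) `^ w i))%E)); last first.
  move=> t _; rewrite mulr_sumr expR_sum -prodEFin.
  by apply: eq_bigr => i Ji; rewrite /g poweR_EFin gwE.
apply: (le_trans (@finner _ _ _ _ _ _ _ _ mX X_indep _ J w A
  w_gt0 w_cover g _ _ _)).
- move=> i; apply/measurable_EFinP.
  apply: measurableT_comp => //; exact: measurable_funM.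
- by move=> i x; rewrite lee_fin expR_ge0.
- by move=> i x y xy; rewrite /g (f_dep _ _ _ xy).
have -> : (expR (lambda ^+ 2 * (\sum_(i | J i) s i / w i) / 2))%:E =
    (\prod_(i | J i)
       (expR ((lambda / w i) ^+ 2 * s i / 2))%:E `^ w i)%E :> \bar R.
  under [RHS]eq_bigr => i Ji.
    rewrite poweR_EFin -expRM.
    over.
  rewrite prodEFin -expR_sum mulr_sumr mulr_suml; congr (expR _)%:E.
  apply: eq_bigr => i Ji; field.
  by rewrite gt_eqF ?w_gt0.
apply: lee_prod => i Ji; rewrite poweR_ge0 andTb.
apply: gt0_ler_poweR.
- by rewrite ltW// w_gt0.
- by rewrite in_itv/= leey integral_ge0// => t _; rewrite lee_fin expR_ge0.
- by rewrite in_itv/= leey lee_fin expR_ge0.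
- by apply: mgf => //; rewrite divr_gt0 ?w_gt0.
Qed.

Lemma subgauss_tail d (T : measurableType d) (R : realType)
    (P : probability T R) (Y : T -> R) (B t : R) :
  measurable_fun setT Y -> 0 < B -> 0 < t ->
  (forall lambda, 0 < lambda ->
    (\int[P]_w (expR (lambda * Y w))%:E
      <= (expR (lambda ^+ 2 * B / 2))%:E)%E) ->
  (P [set w | (Y w > t)%R] <= (expR (- (t ^+ 2 / (2 * B))))%:E)%E.
Proof.
move=> mY B_gt0 t_gt0 mgf.
pose Yrv : {RV P >-> R} := HB.pack Y (isMeasurableFun.Build _ _ _ _ Y mY).
(* lambda = t / B minimises lambda ^ 2 * B / 2 - lambda * t *)
have lambda_gt0 : 0 < t / B by rewrite divr_gt0.
apply: (@le_trans _ _ (P [set w | (Yrv w >= t)%R])).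
  apply: le_measure; rewrite ?inE.
  - rewrite -[X in measurable X]setTI; exact: measurable_fun_ltr.
  - rewrite -[X in measurable X]setTI; exact: measurable_fun_ler.
  - by move=> w /= /ltW.
apply: (le_trans (chernoff Yrv t lambda_gt0)).
apply: (@le_trans _ _ ((expR ((t / B) ^+ 2 * B / 2))%:E
    * (expR (- (t / B * t)))%:E)%E).
  rewrite lee_pmul2r ?lte_fin ?expR_gt0// /mmt_gen_fun.
  rewrite (_ : _ \o _ = fun w => expR (t / B * Y w)).
    by rewrite unlock; exact: mgf lambda_gt0.
  by apply/funext => w /=; rewrite mulrC.
rewrite -EFinM -expRD lee_fin ler_expR.
by rewrite le_eqVlt; apply/orP; left; apply/eqP; field; rewrite gt_eqF.
Qed.

(** * Fractional matchings of the sampled graph *)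

Lemma sum_eq_Tagged (I : finType) (L : I -> nat) (v : {i : I & 'I_(L i)})
    (i : I) :
  (\sum_(l < L i) (v == Tagged (fun i => 'I_(L i)) l) = (tag v == i))%N.
Proof.
case: eqVneq => [<-|tv_neq]; last first.
  by rewrite big1// => l _; case: eqP => // vE; rewrite vE eqxx in tv_neq.
rewrite (bigD1 (tagged v))//= big1 => [|l l_neq].
  by case: v => j l /=; rewrite eqxx.
case: v l l_neq => j l0 l /= l_neq.
by rewrite -tag_eqE /tag_eq/= eqxx tagged_asE eq_sym (negbTE l_neq).
Qed.

(** Each edge at [i] is listed in [E] under exactly one of its two
    orientations, hence is counted once. *)
Lemma degree_edge_pairs (V : finType) (adj : rel V) (E : {set V * V}) (i : V) :
  edge_pairs adj E ->
  (\sum_(e in E) ((i == e.1) + (i == e.2)) = #|[pred j | adj i j]|)%N.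
Proof.
move=> [E_asym adjE]; rewrite big_split/=.
have -> : (\sum_(e in E) (i == e.1) = \sum_j ((i, j) \in E))%N.
  rewrite big_mkcond/=.
  transitivity (\sum_a \sum_b if (a, b) \in E then (i == a : nat) else 0)%N.
    by rewrite pair_bigA; apply: eq_bigr => -[a b].
  rewrite (bigD1 i)//= [X in (_ + X)%N]big1 ?addn0.
    by apply: eq_bigr => j _; rewrite eqxx; case: ifP.
  by move=> a ai; rewrite big1// => b _; rewrite eq_sym (negbTE ai) if_same.
have -> : (\sum_(e in E) (i == e.2) = \sum_j ((j, i) \in E))%N.
  rewrite big_mkcond/=.
  transitivity (\sum_a \sum_b if (a, b) \in E then (i == b : nat) else 0)%N.
    by rewrite pair_bigA; apply: eq_bigr => -[a b].
  apply: eq_bigr => a _; rewrite (bigD1 i)//= big1 ?addn0.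
    by rewrite eqxx; case: ifP.
  by move=> b bi; rewrite eq_sym (negbTE bi) if_same.
rewrite -big_split/= -sum1_card [RHS]big_mkcond/=.
apply: eq_bigr => j _; rewrite inE adjE.
have [ijE|] := boolP ((i, j) \in E); last by case: (_ \in E).
by rewrite (negbTE (E_asym _ _ ijE)).
Qed.

(** The terms of [U1]: an edge together with a sample index at each end. *)
Definition pair_index (V : finType) (L : V -> nat) :=
  {e : V * V & ('I_(L e.1) * 'I_(L e.2))%type}.

Definition left_end (V : finType) (L : V -> nat) (z : pair_index L) :
  {i : V & 'I_(L i)} := Tagged (fun i => 'I_(L i)) (tagged z).1.

Definition right_end (V : finType) (L : V -> nat) (z : pair_index L) :
  {i : V & 'I_(L i)} := Tagged (fun i => 'I_(L i)) (tagged z).2.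

Definition pair_weight (R : realType) (V : finType) (L : V -> nat)
    (adj : rel V) (e : V * V) : R :=
  ((max_degree adj).+1 * maxn (L e.1) (L e.2))%:R^-1.

Lemma big_pair_index (R : Type) (idx : R) (op : Monoid.com_law idx)
    (V : finType) (L : V -> nat) (E : {set V * V}) (F : pair_index L -> R) :
  \big[op/idx]_(z : pair_index L | tag z \in E) F z
  = \big[op/idx]_(e in E) \big[op/idx]_(l < L e.1) \big[op/idx]_(k < L e.2)
      F (Tagged (fun e : V * V => ('I_(L e.1) * 'I_(L e.2))%type) (l, k)).
Proof.
under [RHS]eq_bigr do rewrite pair_bigA.
rewrite sig_big_dep /=.
by apply: eq_big => [[e [l k]]|[e [l k]] _] //=; rewrite andbT.
Qed.

(** The weights [pair_weight] form a fractional matching of the sample points.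
    Over an edge [e] at the node [tag v] there are [L j] pairs through [v],
    with [j] the other end of [e]; they weigh at most
    [1 / (max_degree adj).+1] together. *)
Lemma pair_weight_cover (R : realType) (V : finType) (L : V -> nat)
    (adj : rel V) (E : {set V * V}) (v : {i : V & 'I_(L i)}) :
  edge_pairs adj E -> (forall i, (1 <= L i)%N) ->
  \sum_(z : pair_index L |
      (tag z \in E) && (v \in [set left_end z; right_end z]%SET))
    pair_weight R L adj (tag z) <= 1.
Proof.
move=> E_adj L_ge1; set D := (max_degree adj).+1.
have D_gt0 : 0 < D%:R :> R by rewrite ltr0n.
rewrite big_mkcondr big_pair_index /=.
apply: (@le_trans _ _
  (\sum_(e in E) ((tag v == e.1) + (tag v == e.2))%:R / D%:R)).
  apply: ler_sum => -[a b] _ /=.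
  pose M := maxn (L a) (L b).
  have M_gt0 : (0 < M)%N by rewrite leq_max L_ge1.
  apply: (@le_trans _ _ (\sum_(l < L a) \sum_(k < L b)
      ((v == Tagged (fun i => 'I_(L i)) l) +
       (v == Tagged (fun i => 'I_(L i)) k))%:R * (D * M)%:R^-1)).
    apply: ler_sum => l _; apply: ler_sum => k _.
    rewrite finset.in_set2 /left_end /right_end /= /pair_weight /= -/M -/D.
    have W_ge0 : 0 <= (D * M)%:R^-1 :> R by rewrite invr_ge0.
    case: eqP => _ /=; case: eqP => _ /=; rewrite ?mul1r ?mul0r//.
    by rewrite mulrDl mul1r lerDl.
  under eq_bigr do rewrite -mulr_suml -natr_sum.
  rewrite -mulr_suml -natr_sum natrM invfM mulrCA [leRHS]mulrC.
  rewrite ler_pM2l ?invr_gt0// ler_pdivrMr ?ltr0n// -natrM ler_nat.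
  under eq_bigr do rewrite big_split/= sum_nat_const card_ord sum_eq_Tagged.
  rewrite big_split/= -big_distrr/= sum_eq_Tagged sum_nat_const card_ord.
  by rewrite mulnDl leq_add// mulnC leq_mul// /M leq_max leqnn ?orbT.
rewrite -mulr_suml -natr_sum (degree_edge_pairs _ E_adj).
rewrite ler_pdivrMr// mul1r ler_nat ltnW// ltnS.
exact: (leq_bigmax (F := fun i => #|[pred j | adj i j]|)).
Qed.

Theorem corollary8 (R : realType) (d : measure_display) (T : measurableType d)
  (P : probability T R) (p n : nat) (L : 'I_n -> nat)
  (L_ge1 : forall i, (1 <= L i)%N)
  (X : forall i : 'I_n, 'I_(L i) -> {RV P >-> p.-tuple R})
  (X_indep : mutually_independent P
    (fun il : {i : 'I_n & 'I_(L i)} => X (tag il) (tagged il) : T -> p.-tuple R))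
  (adj : rel 'I_n) (adj_simple : simple_graph adj)
  (E : {set 'I_n * 'I_n}) (E_adj : edge_pairs adj E) (E_neq0 : E != finset.set0)
  (h : 'I_n * 'I_n -> p.-tuple R -> p.-tuple R -> R)
  (h_meas : forall e, e \in E ->
    measurable_fun setT (fun xy : p.-tuple R * p.-tuple R => h e xy.1 xy.2))
  (h_int : forall e, e \in E -> forall (l : 'I_(L e.1)) (k : 'I_(L e.2)),
    P.-integrable setT (fun w => (h e (X e.1 l w) (X e.2 k w))%:E))
  (sigma : 'I_n * 'I_n -> R)
  (sigma_gt0 : forall e, e \in E -> 0 < sigma e)
  (h_subgauss : forall e, e \in E ->
    forall (l : 'I_(L e.1)) (k : 'I_(L e.2)) (lambda : R), 0 < lambda ->
    ('E_P[fun w => expR (lambda * (h e (X e.1 l w) (X e.2 k w)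
             - fine 'E_P[fun w' => h e (X e.1 l w') (X e.2 k w')])%R)]
       <= (expR (lambda ^+ 2 * sigma e ^+ 2 / 2))%:E)%E)
  (t : R) (t_gt0 : 0 < t) :
  (P [set w | (U1 E h X w - fine 'E_P[U1 E h X] > t)%R]
   <= (expR (- (t ^+ 2 / (2 * (max_degree adj).+1%:R *
         \sum_(e in E) (L e.1 * L e.2 * maxn (L e.1) (L e.2))%:R
                        * sigma e ^+ 2))))%:E)%E.
Proof.
have mX (v : {i : 'I_n & 'I_(L i)}) :
  measurable_fun setT (X (tag v) (tagged v)) by [].
pose J (z : pair_index L) := tag z \in E.
(* off the edge set the kernels are unconstrained, hence the truncation *)
pose k (z : pair_index L) := if J z then h (tag z) else fun _ _ => 0.
have kE z : J z -> k z = h (tag z) by move=> zE; rewrite /k zE.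
pose term (z : pair_index L) w :=
  k z (X _ (tagged z).1 w) (X _ (tagged z).2 w).
pose mean z := fine 'E_P[term z].
pose f (z : pair_index L) (x : config (p.-tuple R) {i : 'I_n & 'I_(L i)}) :=
  k z (x (left_end z)) (x (right_end z)) - mean z.
pose W (z : pair_index L) := pair_weight R L adj (tag z).
pose B := \sum_(z : pair_index L | J z) sigma (tag z) ^+ 2 / W z.
have M_gt0 (e : 'I_n * 'I_n) : (0 < maxn (L e.1) (L e.2))%N.
  by rewrite leq_max L_ge1.
have W_gt0 z : 0 < W z by rewrite invr_gt0 ltr0n muln_gt0 M_gt0.
have BE : B = (max_degree adj).+1%:R *
    \sum_(e in E) (L e.1 * L e.2 * maxn (L e.1) (L e.2))%:R * sigma e ^+ 2.
  rewrite /B big_pair_index mulr_sumr; apply: eq_bigr => e _.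
  rewrite /W /= !sumr_const !card_ord -mulrnA -mulr_natl.
  by rewrite /pair_weight invrK !natrM; ring.
have B_gt0 : 0 < B.
  have [e eE] := finset.set0Pn _ E_neq0.
  rewrite BE mulr_gt0// (bigD1 e)//= ltr_wpDr//.
    by apply: sumr_ge0 => e' _; rewrite mulr_ge0// sqr_ge0.
  by rewrite mulr_gt0 ?exprn_gt0 ?sigma_gt0// ltr0n !muln_gt0 !L_ge1 M_gt0.
have term_int z : P.-integrable setT (EFin \o term z).
  rewrite /term /k; case: ifPn => [zE|_]; first exact: h_int.
  exact: integrable0.
have U1E w : U1 E h X w = \sum_(z | J z) term z w.
  rewrite /U1 -(big_pair_index _ E (fun z : pair_index L =>
    h (tag z) (X _ (tagged z).1 w) (X _ (tagged z).2 w))).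
  by apply: eq_bigr => z zE; rewrite /term kE.
have EU1 : fine 'E_P[U1 E h X] = \sum_(z | J z) mean z.
  have -> : ('E_P[U1 E h X] = \sum_(z | J z) 'E_P[term z])%E.
    rewrite unlock (eq_integral (fun w => \sum_(z | J z) (term z w)%:E)%E).
      exact: integral_sum.
    by move=> w _; rewrite U1E sumEFin.
  rewrite -sum_fine// => z _; rewrite unlock.
  exact: integrable_fin_num (term_int z).
have centred w : U1 E h X w - fine 'E_P[U1 E h X]
    = \sum_(z | J z) f z (fun v => X (tag v) (tagged v) w).
  by rewrite U1E EU1 -sumrB.
have mf z : measurable_fun setT (f z).
  apply: measurable_funB => //; rewrite /k.
  case: ifPn => [zE|_]; last exact: measurable_cst.
  apply: (measurableT_comp (h_meas _ zE) (measurable_fun_pair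
    (measurable_coord (left_end z)) (measurable_coord (right_end z)))).
rewrite -mulrA -BE; apply: subgauss_tail => //.
  apply: measurable_funB => //.
  rewrite (_ : U1 E h X = fun w => \sum_(z <- enum J) term z w).
    apply: measurable_sum => z; apply/measurable_EFinP.
    exact: measurable_int (term_int z).
  by apply/funext => w; rewrite U1E big_enum.
move=> lambda lambda_gt0.
under eq_integral do rewrite centred.
apply: (@subgauss_sum _ _ _ _ _ _ _ _ _ J W
  (fun z => sigma (tag z) ^+ 2)
  (fun z => [set left_end z; right_end z]%SET) f mX X_indep _ _ mf) => //.
- by move=> v; exact: pair_weight_cover.
- by move=> z x y xy; rewrite /f !xy// finset.in_set2 eqxx ?orbT.
- move=> z l zE l_gt0.
  have := h_subgauss _ zE (tagged z).1 (tagged z).2 _ l_gt0.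
  rewrite /f /mean /term kE// unlock; exact.
Qed.
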